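(* Let $\mathbf{x}=[q\;\;p]^\top$, let $\mathbf{f}=[f_1\;\;f_2]^\top\in\mathcal{P}_{q,p}^{2\times 1}$ and $\mathbf{g}=[g_1\;\;g_2]^\top\in\mathcal{P}_{q,p}^{2\times 1}$, and consider the QSDEs $$d\mathbf{x}(t)=\mathbf{f}(\mathbf{x}(t))\,dt+\mathbf{g}(\mathbf{x}(t))\,dA(t)^\ast+\mathbf{g}(\mathbf{x}(t))^\ast\,dA(t).$$ For $C\in\mathbb{C}$ put $$Z=\left.\int_o g_1\,dp\right|_{\mathcal{P}_p}-\int_o g_2\,dq,\qquad \mathbb{L}=-i(Z+C),\qquad \mathbf{f}_L=\frac{(\mathbf{g}^\ast\mathbb{L})+(\mathbf{g}^\ast\mathbb{L})^\ast}{2}.$$ Then the following conditions are equivalent: 1. The QSDEs are physically realizable. 2. Both $\mathbf{g}$ and $\mathbf{f}-\mathbf{f}_L$ are commutator-conservative mappings for some $C\in\mathbb{C}$ in the definition of $\mathbb{L}$, and the elements of $\mathbf{f}$ are self-adjoint. 3. Both $\mathbf{g}$ and $\mathbf{f}-\mathbf{f}_L$ are commutator-conservative mappings for any (i.e. every) $C\in\mathbb{C}$ in the definition of $\mathbb{L}$, and the elements of $\mathbf{f}$ are self-adjoint.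
   Context: Let $q,p$ be self-adjoint operators (position and momentum of a single mode, $\hbar=1$) with $[q,p]=qp-pq=i1$, $1$ the identity. $\mathcal{P}_{q,p}$ is the class of functions that can be written as a power series $X=\sum_{j=1}^\infty a_j q^{k_j}p^{l_j}$, $a_j\in\mathbb{C}$, $k_j,l_j\in\mathbb{N}=\{0,1,2,\dots\}$. It is a complex vector space with standard basis $\Phi=\{q^kp^l: k,l\ge 0\}$. Series are handled formally: an element is determined by its coefficients in $q$-$p$ order, linear operations act term by term, and products and adjoints (reordered with $[q,p]=i1$) that occur are understood to be well-defined elements of $\mathcal{P}_{q,p}$. $\mathcal{P}_q$ and $\mathcal{P}_p$ are the subspaces of power series in $q$ alone and in $p$ alone (constants included). $\mathcal{O}_{q,p}=\{X\in\mathcal{P}_{q,p}: X=X^\ast\}$. $\mathcal{P}_{q,p}^{k\times l}$ denotes $k\times l$ matrices over $\mathcal{P}_{q,p}$. For a subspace $\mathcal{A}$ spanned by $\Phi_{\mathcal{A}}\subseteq\Phi$, $X|_{\mathcal{A}}$ is the projection of $X$ obtained by keeping only the terms whose monomial lies in $\Phi_{\mathcal{A}}$. Zero integrals: $\int_o X\,dq$ and $\int_o X\,dp$ are defined termwise by $\int_o q^kp^l\,dq=\frac{1}{k+1}q^{k+1}p^l$ and $\int_o q^kp^l\,dp=\frac{1}{l+1}q^kp^{l+1}$. For a vector $\mathbf{v}=[v_1\;v_2]^\top$ of operators and an operator $Y$: $[\mathbf{v},Y]=[[v_1,Y]\;\;[v_2,Y]]^\top$, $\mathbf{v}^\ast=[v_1^\ast\;v_2^\ast]^\top$,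 $\mathbf{v}Y=[v_1Y\;\;v_2Y]^\top$. Commutator-conservative: $\mathbf{j}\in\mathcal{P}_{q,p}^{2\times1}$ is commutator-conservative if there exists $\mathbb{J}\in\mathcal{P}_{q,p}$ with $\mathbf{j}=-i[\mathbf{x},\mathbb{J}]$. Physically realizable: the QSDE $d\mathbf{x}=\mathbf{f}(\mathbf{x})dt+\mathbf{g}(\mathbf{x})dA^\ast+\mathbf{g}(\mathbf{x})^\ast dA$ ($dA,dA^\ast$ the increments of the annihilation and creation processes of the quantum field) is physically realizable if there exist $\mathbb{H}\in\mathcal{O}_{q,p}$ and $\mathbb{L}\in\mathcal{P}_{q,p}$ such that $\mathbf{f}(\mathbf{x})=-i[\mathbf{x},\mathbb{H}]+\frac12\left[(\mathbf{g}(\mathbf{x})^\ast\mathbb{L})^\ast+\mathbf{g}(\mathbf{x})^\ast\mathbb{L}\right]$ and $\mathbf{g}(\mathbf{x})=[\mathbf{x},\mathbb{L}]$. *)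

(* Defs.v *)
From HB Require Import structures.
From mathcomp Require Import all_boot all_order all_algebra complex.
From mathcomp Require Import all_classical all_reals all_analysis.
Set Implicit Arguments.
Unset Strict Implicit.
Unset Printing Implicit Defensive.
Import Order.TTheory GRing.Theory Num.Theory numFieldNormedType.Exports.

Local Open Scope classical_set_scope.
Local Open Scope ring_scope.

(* X k l is the coefficient of q^k p^l (q to the left of p) in the power
   series X.  Linear operations are the pointwise ones. *)
Definition qpseries (R : realType) : Type := nat -> nat -> R[i].

Definition monom (R : realType) (a b : nat) : qpseries R :=
  fun k l => ((k == a) && (l == b))%:R.

Definition opQ (R : realType) : qpseries R := monom R 1 0.
Definition opP (R : realType) : qpseries R := monom R 0 1.
Definition op1 (R : realType) : qpseries R := monom R 0 0.

(* Convergence of complex series is for the norm of R[i]^o, i.e. the modulus. *)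
Definition csummable (R : realType) (u : nat -> R[i]) : Prop :=
  cvgn (series (u : nat -> R[i]^o)).
Definition csum (R : realType) (u : nat -> R[i]) : R[i] :=
  limn (series (u : nat -> R[i]^o)).

(* The relation [q,p] = i gives
     p^l q^k = \sum_j (-i)^j j! C(l,j) C(k,j) q^(k-j) p^(l-j). *)
Definition qpreord (R : realType) (l k j : nat) : R[i] :=
  (- 'i) ^+ j * (j`! * 'C(l, j) * 'C(k, j))%:R.

(* The coefficient of q^m p^n in X Y collects the terms
   (q^a p^b) (q^c p^d) with a + (c - j) = m and (b - j) + d = n;
   they are summed over the contraction order j, which is the only index
   ranging over an infinite set. *)
Definition qpmul_term (R : realType) (X Y : qpseries R) (m n j : nat) : R[i] :=
  \sum_(a < m.+1) \sum_(d < n.+1)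
    X a (n - d + j)%N * Y (m - a + j)%N d * qpreord R (n - d + j) (m - a + j) j.

Definition qpmul_wd (R : realType) (X Y : qpseries R) : Prop :=
  forall m n, csummable (qpmul_term X Y m n).
Definition qpmul (R : realType) (X Y : qpseries R) : qpseries R :=
  fun m n => csum (qpmul_term X Y m n).

(* (c q^k p^l)^* = c^* p^l q^k, reordered. *)
Definition qpadj_term (R : realType) (X : qpseries R) (m n j : nat) : R[i] :=
  (X (m + j)%N (n + j)%N)^* * qpreord R (n + j) (m + j) j.

Definition qpadj_wd (R : realType) (X : qpseries R) : Prop :=
  forall m n, csummable (qpadj_term X m n).
Definition qpadj (R : realType) (X : qpseries R) : qpseries R :=
  fun m n => csum (qpadj_term X m n).

Definition qpcomm (R : realType) (X Y : qpseries R) : qpseries R :=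
  qpmul X Y - qpmul Y X.

(* P stands for the space of power series in which the operators live: it
   contains the monomials and the adjoint is a well-defined involution of it.
   The last law does not follow from convergence: take x_{kk} = y_k / k!^2,
   the other coefficients being 0, where \sum_k y_k z^k / k! =
   exp (- (1 + i z)^(-1/2)).  All the reordered sums converge, to 0, so that
   qpadj X = 0.  Products are not required to exist in general; those which
   occur are subject to qpmul_in. *)
Record operator_space (R : realType) (P : set (qpseries R)) : Prop :=
  OperatorSpace {
    os_monom : forall k l, P (monom R k l);
    os_linear : forall (c : R[i]) X Y, P X -> P Y -> P (c *: X + Y);
    os_adj_wd : forall X, P X -> qpadj_wd X;
    os_adj : forall X, P X -> P (qpadj X);
    os_adjK : forall X, P X -> qpadj (qpadj X) = X }.

Definition qpmul_in (R : realType) (P : set (qpseries R)) (X Y : qpseries R) :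
  Prop := qpmul_wd X Y /\ P (qpmul X Y).

Definition qprestr (R : realType) (S : pred (nat * nat)) (X : qpseries R) :
  qpseries R := fun k l => if S (k, l) then X k l else 0.

(* The monomials spanning the power series in p alone. *)
Definition p_only : pred (nat * nat) := fun kl => kl.1 == 0%N.

Definition int_q (R : realType) (X : qpseries R) : qpseries R :=
  fun k l => if k is k'.+1 then X k' l / k%:R else 0.
Definition int_p (R : realType) (X : qpseries R) : qpseries R :=
  fun k l => if l is l'.+1 then X k l' / l%:R else 0.

Definition xvec (R : realType) : 'cV[qpseries R]_2 :=
  \col_(i < 2) (if i == 0 then opQ R else opP R).

Definition vscale (R : realType) (c : R[i]) (v : 'cV[qpseries R]_2) :
  'cV[qpseries R]_2 := map_mx (fun X => c *: X) v.
Definition vcomm (R : realType) (v : 'cV[qpseries R]_2) (Y : qpseries R) :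
  'cV[qpseries R]_2 := map_mx (fun X => qpcomm X Y) v.
Definition vadj (R : realType) (v : 'cV[qpseries R]_2) : 'cV[qpseries R]_2 :=
  map_mx (@qpadj R) v.
Definition vmul (R : realType) (v : 'cV[qpseries R]_2) (Y : qpseries R) :
  'cV[qpseries R]_2 := map_mx (fun X => qpmul X Y) v.

Definition in_space (R : realType) (P : set (qpseries R))
  (v : 'cV[qpseries R]_2) : Prop := forall i, P (v i 0).

Definition self_adjoint (R : realType) (X : qpseries R) : Prop := qpadj X = X.

Definition comm_conservative (R : realType) (P : set (qpseries R))
  (j : 'cV[qpseries R]_2) : Prop :=
  exists J : qpseries R, P J /\ j = vscale (- 'i) (vcomm (xvec R) J).

(* The QSDE dx = f(x) dt + g(x) dA^* + g(x)^* dA is represented by its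
   coefficients f and g. *)
Definition physically_realizable (R : realType) (P : set (qpseries R))
  (f g : 'cV[qpseries R]_2) : Prop :=
  exists H L : qpseries R,
    [/\ P H, self_adjoint H & P L] /\
    [/\ forall i, qpmul_in P (vadj g i 0) L,
        f = vscale (- 'i) (vcomm (xvec R) H)
            + vscale 2^-1 (vadj (vmul (vadj g) L) + vmul (vadj g) L)
      & g = vcomm (xvec R) L].

Definition opZ (R : realType) (g : 'cV[qpseries R]_2) : qpseries R :=
  qprestr p_only (int_p (g 0 0)) - int_q (g 1 0).
Definition opL (R : realType) (g : 'cV[qpseries R]_2) (C : R[i]) : qpseries R :=
  - 'i *: (opZ g + C *: op1 R).
Definition fL (R : realType) (g : 'cV[qpseries R]_2) (C : R[i]) :
  'cV[qpseries R]_2 :=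
  vscale 2^-1 (vmul (vadj g) (opL g C) + vadj (vmul (vadj g) (opL g C))).

(* Main.v *)
Require Import Defs.
From HB Require Import structures.
From mathcomp Require Import all_boot all_order all_algebra complex.
From mathcomp Require Import zify ring.
From mathcomp Require Import all_classical all_reals all_analysis.
Set Implicit Arguments.
Unset Strict Implicit.
Unset Printing Implicit Defensive.
Import Order.TTheory GRing.Theory Num.Theory numFieldNormedType.Exports.
Local Open Scope classical_set_scope.
Local Open Scope ring_scope.

(** Write [ham J = (dJ/dp, -dJ/dq)], so that [-i[x, J] = ham J].  On series the
    operator [J |-> opZ (ham J)] is a left inverse of [ham] up to constants, so
    [g = [x, L]] forces [L = opL g C] with [C] fixed by the constant term of
    [L].  Two facts then give the equivalence.  The adjoint commutes with
    [ham], because it commutes with [d/dq] and [d/dp] term by term.  Changing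
    [C] adds to [L] a constant [D], hence to [fL] the vector
    [(D g^* + D^* g) / 2], which is again of the form [ham K].  Conversely, if
    [f - fL = ham K] with [f] self-adjoint, [K] may be replaced by its
    self-adjoint part, which is the Hamiltonian. *)

(** * Sums of complex series: linearity and eventually zero terms *)

Lemma series_linear (K : numFieldType) (V : normedModType K) (c : K)
    (u v : nat -> V) : cvgn (series u) -> cvgn (series v) ->
  cvgn (series (fun j => c *: u j + v j)) /\
  limn (series (fun j => c *: u j + v j)) = c *: limn (series u) + limn (series v).
Proof.
move=> su sv; rewrite -[fun j => _]/(c *: u + v) seriesD seriesZ.
have su' : cvgn (c *: series u) by exact: is_cvgZl_tmp.
by split; [exact: is_cvgD | rewrite limD // limZl_tmp].
Qed.

Section Summation.
Variable R : realType.
Implicit Types (u v : nat -> R[i]) (c : R[i]).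

(** On [R[i]^o] scaling is multiplication, so the normed-module statement applies up to
    conversion. *)
Lemma csum_linear c u v : csummable u -> csummable v ->
  csummable (fun j => c * u j + v j) /\
  csum (fun j => c * u j + v j) = c * csum u + csum v.
Proof. exact: (@series_linear R[i] R[i]^o c u v). Qed.

Lemma csum_finite N u : (forall j, (N <= j)%N -> u j = 0) ->
  csummable u /\ csum u = \sum_(j < N) u j.
Proof.
move=> u0; suff H : series (u : nat -> R[i]^o) @ \oo --> (\sum_(j < N) u j : R[i]^o).
  by split; [exact: (cvgP _ H) | exact: (cvg_lim _ H)].
apply: cvg_near_cst; exists N => // n /= Nn.
rewrite /series /= (big_cat_nat (n := N)) //= big_mkord.
rewrite [X in _ + X]big_nat_cond [X in _ + X]big1 ?addr0 // => j /andP[/andP[Nj _] _].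
exact: u0.
Qed.

End Summation.

(** Multiplication by a monomial leaves at most one pair of indices in each contraction order. The
    conditional covers the case where that pair falls outside the summation range. *)
Lemma double_sum_single (V : zmodType) m n (F : nat -> nat -> V) a0 d0 :
  (forall a d, (a <= m)%N -> (d <= n)%N -> (a, d) != (a0, d0) -> F a d = 0) ->
  \sum_(a < m.+1) \sum_(d < n.+1) F a d =
  if (a0 <= m)%N && (d0 <= n)%N then F a0 d0 else 0.
Proof.
move=> F0; case: ifPn => [/andP[am dn] | adP].
  rewrite (bigD1 (Ordinal (am : (a0 < m.+1)%N))) //=.
  rewrite [X in _ + X]big1 ?addr0 => [|a na]; last first.
    by rewrite big1 // => d _; apply: F0; rewrite ?leq_ord // xpair_eqE negb_and; apply/orP; left.
  rewrite (bigD1 (Ordinal (dn : (d0 < n.+1)%N))) //= big1 ?addr0 // => d nd.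
  by apply: F0; rewrite ?leq_ord // xpair_eqE eqxx.
rewrite big1 // => a _; rewrite big1 // => d _; apply: F0; rewrite ?leq_ord //.
apply: contra adP; rewrite xpair_eqE => /andP[/eqP <- /eqP <-].
by rewrite !leq_ord.
Qed.

(** * Termwise partial derivatives, and the commutators of [q] and [p] with a series *)

Section Calculus.
Variable R : realType.
Implicit Types (X Y : qpseries R) (c : R[i]).

Definition dq X : qpseries R := fun m n => m.+1%:R * X m.+1 n.
Definition dp X : qpseries R := fun m n => n.+1%:R * X m n.+1.

Lemma qplinE c X Y m n : (c *: X + Y) m n = c * X m n + Y m n.
Proof. by []. Qed.

Lemma qpscaleE c X m n : (c *: X) m n = c * X m n.
Proof. by []. Qed.

Lemma dq_linear c X Y : dq (c *: X + Y) = c *: dq X + dq Y.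
Proof. by apply/funext => m; apply/funext => n; rewrite /dq !qplinE mulrDr mulrCA. Qed.

Lemma dp_linear c X Y : dp (c *: X + Y) = c *: dp X + dp Y.
Proof. by apply/funext => m; apply/funext => n; rewrite /dp !qplinE mulrDr mulrCA. Qed.

Lemma qpreord0 l k : qpreord R l k 0 = 1.
Proof. by rewrite /qpreord expr0 !bin0 mul1r. Qed.

Lemma qpmul_term_single X Y m n j a0 d0 :
  (forall a d, (a <= m)%N -> (d <= n)%N -> (a, d) != (a0, d0) ->
     X a (n - d + j)%N * Y (m - a + j)%N d = 0) ->
  qpmul_term X Y m n j =
  if (a0 <= m)%N && (d0 <= n)%N then
    X a0 (n - d0 + j)%N * Y (m - a0 + j)%N d0 *
    qpreord R (n - d0 + j) (m - a0 + j) j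
  else 0.
Proof.
move=> F0; rewrite -[RHS](double_sum_single (F := fun a d =>
  X a (n - d + j)%N * Y (m - a + j)%N d *
  qpreord R (n - d + j) (m - a + j) j)) // => a d am dn /F0 -> //.
by rewrite mul0r.
Qed.

Lemma monom0 a b k l : (k, l) != (a, b) -> monom R a b k l = 0.
Proof. by rewrite /monom xpair_eqE => /negbTE ->. Qed.

Lemma monom1 a b : monom R a b a b = 1.
Proof. by rewrite /monom !eqxx. Qed.

(** In [q Y] the factor [q] is already on the left, so only contraction order 0 occurs. In [Y q]
    order 0 gives the same shifted series, which cancels, and order 1 gives [- 'i *: dp Y], as in
    p^l q = q p^l - i l p^(l-1). *)
Lemma qpcomm_opQ Y : qpcomm (opQ R) Y = 'i *: dp Y.
Proof.
rewrite /opQ; apply/funext => m; apply/funext => n.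
have -> : qpcomm (monom R 1 0) Y m n = qpmul (monom R 1 0) Y m n - qpmul Y (monom R 1 0) m n by [].
have E1 : qpmul (monom R 1 0) Y m n = if (0 < m)%N then Y m.-1 n else 0.
  have /csum_finite[_] : forall j, (1 <= j)%N -> qpmul_term (monom R 1 0) Y m n j = 0.
    move=> j j1; rewrite /qpmul_term big1 // => a _; rewrite big1 // => d _.
    by rewrite monom0 ?mul0r // xpair_eqE /=; lia.
  rewrite big_ord1 /qpmul => ->; rewrite (@qpmul_term_single _ _ _ _ _ 1 n).
    rewrite leqnn andbT subnn addn0 monom1 qpreord0 mul1r mulr1 subn1 addn0.
    by case: ifP.
  by move=> a d am dn; rewrite xpair_eqE => ne;
    rewrite monom0 ?mul0r // xpair_eqE /=; lia.
have E2 : qpmul Y (monom R 1 0) m n = (if (0 < m)%N then Y m.-1 n else 0) - 'i * dp Y m n.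
  (* At least [j] powers of [q] must come from the right factor, which has only one. *)
  have /csum_finite[_] : forall j, (2 <= j)%N -> qpmul_term Y (monom R 1 0) m n j = 0.
    move=> j j1; rewrite /qpmul_term big1 // => a _; rewrite big1 // => d _.
    by rewrite monom0 ?mulr0 ?mul0r // xpair_eqE /=; lia.
  rewrite big_ord_recr big_ord1 /qpmul /= => ->; congr (_ + _).
    (* For [m = 0] the truncated predecessor is again 0, and the selected term vanishes because
       [monom R 1 0] has no constant coefficient. *)
    rewrite (@qpmul_term_single _ _ _ _ _ m.-1 0).
      case: (m) => [|m'] /=.
        by rewrite monom0 ?mulr0 ?mul0r.
      rewrite leqnSn subSnn subn0 !addn0 monom1 qpreord0 !mulr1.
      by rewrite /=.
    by move=> a d am dn; rewrite xpair_eqE => ne;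
      rewrite monom0 ?mulr0 // xpair_eqE /=; lia.
  rewrite (@qpmul_term_single _ _ _ _ _ m 0).
    rewrite leqnn subnn subn0 add0n monom1 mulr1 /= /qpreord /dp addn1 expr1.
    by rewrite !bin1 mul1n muln1; ring.
  by move=> a d am dn; rewrite xpair_eqE => ne;
    rewrite monom0 ?mulr0 // xpair_eqE /=; lia.
by rewrite E1 E2 qpscaleE; ring.
Qed.

(** The mirror image: now [Y p] is already ordered, and the contraction of order 1 comes from [p Y],
    which accounts for the opposite sign. *)
Lemma qpcomm_opP Y : qpcomm (opP R) Y = (- 'i) *: dq Y.
Proof.
rewrite /opP; apply/funext => m; apply/funext => n.
have -> : qpcomm (monom R 0 1) Y m n = qpmul (monom R 0 1) Y m n - qpmul Y (monom R 0 1) m n by [].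
have E1 : qpmul Y (monom R 0 1) m n = if (0 < n)%N then Y m n.-1 else 0.
  have /csum_finite[_] : forall j, (1 <= j)%N -> qpmul_term Y (monom R 0 1) m n j = 0.
    move=> j j1; rewrite /qpmul_term big1 // => a _; rewrite big1 // => d _.
    by rewrite monom0 ?mulr0 ?mul0r // xpair_eqE /=; lia.
  rewrite big_ord1 /qpmul => ->; rewrite (@qpmul_term_single _ _ _ _ _ m 1).
    rewrite leqnn subnn !addn0 monom1 qpreord0 !mulr1 subn1.
    by case: ifP.
  by move=> a d am dn; rewrite xpair_eqE => ne;
    rewrite monom0 ?mulr0 // xpair_eqE /=; lia.
have E2 : qpmul (monom R 0 1) Y m n = (if (0 < n)%N then Y m n.-1 else 0) - 'i * dq Y m n.
  have /csum_finite[_] : forall j, (2 <= j)%N -> qpmul_term (monom R 0 1) Y m n j = 0.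
    move=> j j1; rewrite /qpmul_term big1 // => a _; rewrite big1 // => d _.
    by rewrite monom0 ?mul0r // xpair_eqE /=; lia.
  rewrite big_ord_recr big_ord1 /qpmul /= => ->; congr (_ + _).
    rewrite (@qpmul_term_single _ _ _ _ _ 0 n.-1).
      case: (n) => [|n'] /=.
        by rewrite monom0 ?mul0r.
      rewrite leqnSn subSnn subn0 !addn0 monom1 qpreord0 mulr1 mul1r.
      by rewrite /=.
    by move=> a d am dn; rewrite xpair_eqE => ne;
      rewrite monom0 ?mul0r // xpair_eqE /=; lia.
  rewrite (@qpmul_term_single _ _ _ _ _ 0 n).
    rewrite leqnn subnn subn0 add0n monom1 mul1r /= /qpreord /dq addn1 expr1.
    by rewrite !bin1 !mul1n; ring.
  by move=> a d am dn; rewrite xpair_eqE => ne;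
    rewrite monom0 ?mul0r // xpair_eqE /=; lia.
by rewrite E1 E2 qpscaleE; ring.
Qed.

(** * Right multiplication by the identity, and linearity of the product in its right factor *)

Lemma qpmul_term_op1 X m n j :
  qpmul_term X (op1 R) m n j = if j is 0%N then X m n else 0.
Proof.
rewrite /op1; rewrite (@qpmul_term_single _ _ _ _ _ m 0).
  rewrite leqnn subnn subn0 /=; case: j => [|j].
    by rewrite addn0 monom1 qpreord0 !mulr1.
  by rewrite monom0 // mulr0 mul0r.
by move=> a d am dn; rewrite xpair_eqE => ne;
  rewrite monom0 ?mulr0 // xpair_eqE /=; lia.
Qed.

Lemma qpmul_op1r X : qpmul_wd X (op1 R) /\ qpmul X (op1 R) = X.
Proof.
have H m n : csummable (qpmul_term X (op1 R) m n) /\ 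
    csum (qpmul_term X (op1 R) m n) = \sum_(j < 1) qpmul_term X (op1 R) m n j.
  by apply: csum_finite => j; rewrite qpmul_term_op1; case: j.
split=> [m n|]; first by have [] := H m n.
apply/funext => m; apply/funext => n; have [_] := H m n.
by rewrite big_ord1 qpmul_term_op1.
Qed.

Lemma qpmul_linear_r c X Y Z : qpmul_wd X Y -> qpmul_wd X Z ->
  qpmul X (c *: Y + Z) = c *: qpmul X Y + qpmul X Z.
Proof.
move=> XY XZ; apply/funext => m; apply/funext => n.
have [_] := csum_linear c (XY m n) (XZ m n).
rewrite qplinE => <-; congr csum; apply/funext => j.
rewrite /qpmul_term mulr_sumr -big_split /=; apply: eq_bigr => a _.
rewrite mulr_sumr -big_split /=; apply: eq_bigr => d _.
by rewrite qplinE; ring.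
Qed.

(** * The adjoint: conjugate linearity and compatibility with the derivatives *)

Lemma qpadj_linear c X Y : qpadj_wd X -> qpadj_wd Y ->
  qpadj_wd (c *: X + Y) /\ qpadj (c *: X + Y) = c^* *: qpadj X + qpadj Y.
Proof.
move=> wX wY.
have E m n : qpadj_term (c *: X + Y) m n =
    (fun j => c^* * qpadj_term X m n j + qpadj_term Y m n j).
  by apply/funext => j; rewrite /qpadj_term qplinE rmorphD rmorphM; ring.
split=> [m n|]; first by rewrite E; have [] := csum_linear c^* (wX m n) (wY m n).
apply/funext => m; apply/funext => n; rewrite qplinE /qpadj E.
by have [_ ->] := csum_linear c^* (wX m n) (wY m n).
Qed.

Lemma csum_scale c (u : nat -> R[i]) : csummable u ->
  csummable (fun j => c * u j) /\ csum (fun j => c * u j) = c * csum u.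
Proof.
move=> su; have [s0 e0] : csummable (fun=> 0 : R[i]) /\ csum (fun=> 0 : R[i]) = 0.
  by have [] := @csum_finite R 0 (fun=> 0) (fun _ _ => erefl); rewrite big_ord0.
by have := csum_linear c su s0; rewrite e0 addr0; under eq_fun do rewrite addr0.
Qed.

(** The two reordered series agree term by term, by (n+j+1) C(n+j, j) = (n+1) C(n+j+1, j).
    Convergence for [dp X] is thus inherited from [X] at the index [n.+1], without any exchange of
    limits. *)
Lemma qpadj_dp X : qpadj_wd X ->
  qpadj_wd (dp X) /\ qpadj (dp X) = dp (qpadj X).
Proof.
move=> wX.
have E m n : qpadj_term (dp X) m n = (fun j => n.+1%:R * qpadj_term X m n.+1 j).
  apply/funext => j; rewrite /qpadj_term /dp rmorphM rmorph_nat addSn /qpreord.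
  have key : (n + j).+1%:R * (j`! * 'C(n + j, j) * 'C(m + j, j))%:R =
     n.+1%:R * (j`! * 'C((n + j).+1, j) * 'C(m + j, j))%:R :> R[i].
    rewrite -!natrM; congr _%:R; have := mul_bin_down (n + j).+1 j.
    rewrite subSn ?leq_addl // addnK /= => e.
    by rewrite !mulnA ![(_ * j`!)%N]mulnC -!mulnA !(mulnA _.+1) e.
  by rewrite [X in X * _ = _]mulrC mulrACA key mulrCA -mulrA.
split=> [m n|]; first by rewrite E; have [] := csum_scale n.+1%:R (wX m n.+1).
apply/funext => m; apply/funext => n; rewrite /qpadj E /dp.
by have [_ ->] := csum_scale n.+1%:R (wX m n.+1).
Qed.

(** The same binomial identity, applied to the other binomial coefficient of [qpreord]. *)
Lemma qpadj_dq X : qpadj_wd X ->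
  qpadj_wd (dq X) /\ qpadj (dq X) = dq (qpadj X).
Proof.
move=> wX.
have E m n : qpadj_term (dq X) m n = (fun j => m.+1%:R * qpadj_term X m.+1 n j).
  apply/funext => j; rewrite /qpadj_term /dq rmorphM rmorph_nat addSn /qpreord.
  have key : (m + j).+1%:R * (j`! * 'C(n + j, j) * 'C(m + j, j))%:R =
     m.+1%:R * (j`! * 'C(n + j, j) * 'C((m + j).+1, j))%:R :> R[i].
    rewrite -!natrM; congr _%:R; have := mul_bin_down (m + j).+1 j.
    by rewrite subSn ?leq_addl // addnK /= => e; rewrite mulnCA e mulnCA.
  by rewrite [X in X * _ = _]mulrC mulrACA key mulrCA -mulrA.
split=> [m n|]; first by rewrite E; have [] := csum_scale m.+1%:R (wX m.+1 n).
apply/funext => m; apply/funext => n; rewrite /qpadj E /dq.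
by have [_ ->] := csum_scale m.+1%:R (wX m.+1 n).
Qed.

(** * Hamiltonian vector fields and the recovery of their potential *)

Definition ham X : 'cV[qpseries R]_2 :=
  \col_(i < 2) (if i == 0 then dp X else - dq X).

Lemma ham_linear c X Y i : ham (c *: X + Y) i 0 = c *: ham X i 0 + ham Y i 0.
Proof.
rewrite !mxE dp_linear dq_linear; case: ifP => // _.
by rewrite opprD scalerN.
Qed.

Lemma ham0 i : ham 0 i 0 = 0.
Proof. by have := ham_linear (-1) 0 0 i; rewrite !scaleN1r oppr0 addr0 addNr. Qed.

Lemma hamD X Y i : ham (X + Y) i 0 = ham X i 0 + ham Y i 0.
Proof. by have := ham_linear 1 X Y i; rewrite !scale1r. Qed.

Lemma hamZ c X i : ham (c *: X) i 0 = c *: ham X i 0.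
Proof. by have := ham_linear c X 0 i; rewrite ham0 !addr0. Qed.

Lemma ham_op1 i : ham (op1 R) i 0 = 0.
Proof.
rewrite mxE; case: ifP => _; apply/funext => m; apply/funext => n.
  by rewrite /dp /op1 monom0 ?mulr0 // xpair_eqE andbF.
have -> : (- dq (op1 R)) m n = - (m.+1%:R * op1 R m.+1 n) by [].
by rewrite /op1 monom0 ?mulr0 ?oppr0.
Qed.

Lemma vcomm_xvec X : vcomm (xvec R) X = vscale 'i (ham X).
Proof.
apply/matrixP => i j; rewrite !mxE; case: ifP => _.
  by rewrite qpcomm_opQ.
by rewrite qpcomm_opP scaleNr scalerN.
Qed.

Lemma vscale_vcomm_xvec X : vscale (- 'i) (vcomm (xvec R) X) = ham X.
Proof.
rewrite vcomm_xvec; apply/matrixP => i j; rewrite !mxE scalerA mulNr.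
by rewrite -expr2 sqrCi opprK scale1r.
Qed.

Lemma qpadj0 : qpadj_wd (0 : qpseries R) /\ qpadj (0 : qpseries R) = 0.
Proof.
have E m n : qpadj_term (0 : qpseries R) m n = fun=> 0.
  by apply/funext => j; rewrite /qpadj_term rmorph0 mul0r.
have [s0 e0] := @csum_finite R 0 (fun=> 0) (fun _ _ => erefl).
split=> [m n|]; first by rewrite E.
by apply/funext => m; apply/funext => n; rewrite /qpadj E e0 big_ord0.
Qed.

Lemma qpadjZ c X : qpadj_wd X ->
  qpadj_wd (c *: X) /\ qpadj (c *: X) = c^* *: qpadj X.
Proof.
move=> wX; have [w0 e0] := qpadj0.
by have := qpadj_linear c wX w0; rewrite e0 !addr0.
Qed.

Lemma qpadjD X Y : qpadj_wd X -> qpadj_wd Y ->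
  qpadj_wd (X + Y) /\ qpadj (X + Y) = qpadj X + qpadj Y.
Proof. by move=> wX wY; have := qpadj_linear 1 wX wY; rewrite rmorph1 !scale1r. Qed.

Lemma qpadj_ham X i : qpadj_wd X ->
  qpadj_wd (ham X i 0) /\ qpadj (ham X i 0) = ham (qpadj X) i 0.
Proof.
move=> wX; rewrite !mxE; case: ifP => _; first exact: qpadj_dp.
have [wdq edq] := qpadj_dq wX.
by have := qpadjZ (-1) wdq; rewrite edq rmorphN1 !scaleN1r.
Qed.

(** The q-integral of [dq J] returns the terms of [J] of positive degree in [q], and the restricted
    p-integral of [dp J] returns the pure powers of [p]. No term is counted twice, and only the
    constant [J 0 0] is lost; [C] takes its place. *)
Lemma opL_ham J C :
  opL (ham J) C = - 'i *: J + (- 'i * (C - J 0%N 0%N)) *: op1 R.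
Proof.
apply/funext => k; apply/funext => l; rewrite qplinE.
have -> : opL (ham J) C k l = - 'i * ((qprestr p_only (int_p (ham J 0 0)) k l
  - int_q (ham J 1 0) k l) + C * op1 R k l) by [].
have -> : ((- 'i * (C - J 0%N 0%N)) *: op1 R) k l =
  - 'i * (C - J 0%N 0%N) * op1 R k l by [].
suff -> : qprestr p_only (int_p (ham J 0 0)) k l - int_q (ham J 1 0) k l =
    J k l - J 0%N 0%N * op1 R k l by ring.
rewrite !mxE /= /qprestr /p_only /int_p /int_q /op1 /=.
have nz n : n.+1%:R != 0 :> R[i] by rewrite pnatr_eq0.
case: k => [|k] /=; last first.
  rewrite monom0 // mulr0 subr0 sub0r.
  have -> : (- dq J) k l = - (k.+1%:R * J k.+1 l) by [].
  by rewrite mulNr opprK mulrAC mulfV ?mul1r.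
rewrite subr0; case: l => [|l]; first by rewrite monom1 mulr1 subrr.
by rewrite monom0 // mulr0 subr0 /dp mulrAC mulfV ?mul1r.
Qed.

End Calculus.

(** * Realizability expressed through potentials in the operator space *)

Section Realizability.
Variables (R : realType) (P : set (qpseries R)).
Hypothesis hP : operator_space P.
Implicit Types (X Y H J K : qpseries R) (c C : R[i]).

Lemma space0 : P 0.
Proof.
have P1 := os_monom hP 0 0.
by have := os_linear hP (-1) P1 P1; rewrite scaleN1r addNr.
Qed.

Lemma spaceZ c X : P X -> P (c *: X).
Proof. by move=> PX; have := os_linear hP c PX space0; rewrite addr0. Qed.

Lemma spaceD X Y : P X -> P Y -> P (X + Y).
Proof. by move=> PX PY; have := os_linear hP 1 PX PY; rewrite scale1r. Qed.

(** The involution law swaps the two summands, and 1/2 is real. This serves both for the entries of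
    [fL] and for the construction of the Hamiltonian. *)
Lemma self_adjoint_re X : P X -> self_adjoint (2^-1 *: (X + qpadj X)).
Proof.
move=> PX; have PX' := os_adj hP PX.
have wX := os_adj_wd hP PX; have wX' := os_adj_wd hP PX'.
have [wS eS] := qpadjD wX wX'; have [_ e] := qpadjZ 2^-1 wS.
by rewrite /self_adjoint e eS (os_adjK hP PX) addrC fmorphV rmorph_nat.
Qed.

Lemma comm_conservativeE (j : 'cV[qpseries R]_2) :
  comm_conservative P j <-> exists2 J, P J & j = ham J.
Proof.
by split=> [[J [PJ ->]]|[J PJ ->]]; exists J; rewrite ?vscale_vcomm_xvec.
Qed.

Variable g : 'cV[qpseries R]_2.
Hypothesis hg : in_space P g.
Hypothesis hgL : forall C i, qpmul_in P (vadj g i 0) (opL g C).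

Lemma fLE C i : fL g C i 0 =
  2^-1 *: (qpmul (vadj g i 0) (opL g C) + qpadj (qpmul (vadj g i 0) (opL g C))).
Proof. by rewrite !mxE. Qed.

Lemma fL_shift J C C' : P J -> g = ham J ->
  exists2 K, P K & fL g C = ham K + fL g C'.
Proof.
move=> PJ gJ; pose D := - 'i * (C - C').
have PJ' := os_adj hP PJ.
(* The two coupling operators differ by [D *: op1 R], which adds D g^* to the product and D^* g to
   its adjoint. Since g^* = [ham (qpadj J)] entrywise, half their sum is [ham] of this witness. *)
exists (2^-1 *: (D *: qpadj J + D^* *: J)).
  by apply: spaceZ; apply: spaceD; apply: spaceZ.
apply/matrixP => i k; rewrite [k]ord1 {k} [RHS]mxE hamZ hamD !hamZ !fLE.
have [wC' PC'] := hgL C' i.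
have [_ eadj] := qpadj_ham i (os_adj_wd hP PJ).
have gi : vadj g i 0 = ham (qpadj J) i 0 by rewrite mxE gJ eadj.
have [w1 e1] := qpmul_op1r (vadj g i 0).
have -> : opL g C = D *: op1 R + opL g C'.
  by rewrite /opL /D !scalerDr !scalerA addrCA -scalerDl; congr (_ + _ *: _); ring.
rewrite qpmul_linear_r // e1.
have wgi : qpadj_wd (vadj g i 0).
  by rewrite mxE; apply: (os_adj_wd hP); apply: (os_adj hP).
have [_ ->] := qpadj_linear D wgi (os_adj_wd hP PC').
have -> : qpadj (vadj g i 0) = ham J i 0 by rewrite mxE (os_adjK hP (hg i)) gJ.
by rewrite addrACA scalerDr gi.
Qed.

(** The coupling operator is traded for a potential [J] of [g] and a constant: L = -i J up to a
    constant, and every such L has the form [opL g C]. *)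
Lemma physically_realizableE (f : 'cV[qpseries R]_2) :
  physically_realizable P f g <->
  exists H J C, [/\ P H, self_adjoint H, P J, g = ham J & f = ham H + fL g C].
Proof.
have fLC C : fL g C = vscale 2^-1 (vadj (vmul (vadj g) (opL g C))
    + vmul (vadj g) (opL g C)) by rewrite addrC.
split=> [[H [L [[PH sH PL] [_ fE gE]]]]|[H [J [C [PH sH PJ gJ fE]]]]].
  have gJ : g = ham ('i *: L).
    rewrite gE vcomm_xvec; apply/matrixP => i j.
    by rewrite [j]ord1 hamZ mxE.
  (* With [C] equal to the constant term of the potential, the [op1] term of [opL_ham] vanishes and
     [opL g C] is exactly [L]. *)
  exists H, ('i *: L), (('i *: L) 0%N 0%N).
  split=> //; first exact: spaceZ.
  rewrite fLC {2 4}gJ opL_ham subrr mulr0 scale0r addr0 scalerA mulNr -expr2.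
  by rewrite sqrCi opprK scale1r fE vscale_vcomm_xvec.
exists H, (opL g C); split.
  split=> //; rewrite gJ opL_ham; apply: spaceD; apply: spaceZ => //.
  exact: (os_monom hP).
split=> //; first by rewrite vscale_vcomm_xvec -fLC.
(* [opL g C] may differ from -i J by a constant, but [ham] annihilates constants. *)
rewrite {2}gJ opL_ham vcomm_xvec gJ; apply/matrixP => i j; rewrite [j]ord1.
rewrite [RHS]mxE hamD !hamZ ham_op1 scaler0 addr0 scalerA mulrN -expr2.
by rewrite sqrCi opprK scale1r.
Qed.

End Realizability.

Theorem theorem27 (R : realType) (P : set (qpseries R))
  (hP : operator_space P)
  (f g : 'cV[qpseries R]_2) (hf : in_space P f) (hg : in_space P g)
  (hgL : forall (C : R[i]) (i : 'I_2), qpmul_in P (vadj g i 0) (opL g C)) :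
  (physically_realizable P f g <->
   ((exists C : R[i],
       comm_conservative P g /\ comm_conservative P (f - fL g C)) /\
    (forall i : 'I_2, self_adjoint (f i 0)))) /\
  (physically_realizable P f g <->
   ((forall C : R[i],
       comm_conservative P g /\ comm_conservative P (f - fL g C)) /\
    (forall i : 'I_2, self_adjoint (f i 0)))).
Proof.
have fL_self C i : self_adjoint (fL g C i 0).
  by rewrite fLE; apply: (self_adjoint_re hP); have [] := hgL C i.
have fL_wd C i : qpadj_wd (fL g C i 0).
  rewrite fLE; apply: (os_adj_wd hP); apply: (spaceZ hP); have [_ PW] := hgL C i.
  by apply: (spaceD hP) => //; apply: (os_adj hP).
have real_all : physically_realizable P f g ->
    (forall C, comm_conservative P g /\ comm_conservative P (f - fL g C)) /\
    (forall i, self_adjoint (f i 0)).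
  move=> /(physically_realizableE hP hgL) [H [J [C [PH sH PJ gJ fE]]]].
  split=> [C'|i].
    split; first by apply/comm_conservativeE; exists J.
    have [K PK fLK] := fL_shift hP hg hgL C C' PJ gJ.
    (* Passing from [C] to [C'] replaces the potential [H] of the drift remainder by [H + K]. *)
    apply/comm_conservativeE; exists (H + K); first exact: (spaceD hP).
    rewrite fE fLK addrA addrK; apply/matrixP => i j.
    by rewrite [j]ord1 [LHS]mxE hamD.
  have [wH eH] := qpadj_ham i (os_adj_wd hP PH).
  have [_ e] := qpadjD wH (fL_wd C i).
  by rewrite /self_adjoint fE [(_ + _ : 'cV_2) i 0]mxE e eH sH fL_self.
have some_real C : comm_conservative P g -> comm_conservative P (f - fL g C) ->
    (forall i, self_adjoint (f i 0)) -> physically_realizable P f g.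
  move=> /comm_conservativeE[J PJ gJ] /comm_conservativeE[K PK fK] f_self.
  apply/(physically_realizableE hP hgL).
  have PK' := os_adj hP PK.
  (* [K] itself need not be self-adjoint; its self-adjoint part serves as Hamiltonian. *)
  exists (2^-1 *: (K + qpadj K)), J, C; split=> //.
  - by apply: (spaceZ hP); apply: (spaceD hP).
  - exact: (self_adjoint_re hP PK).
  (* The entries of [ham K] = [f - fL g C] are self-adjoint, and the adjoint commutes with [ham].
     Averaging [K] with its adjoint therefore leaves [ham K] unchanged. *)
  have hamK i : ham (qpadj K) i 0 = ham K i 0.
    have [_ <-] := qpadj_ham i (os_adj_wd hP PK).
    have -> : ham K i 0 = f i 0 + (-1) *: fL g C i 0 by rewrite -fK !mxE scaleN1r.
    have [wN eN] := qpadjZ (-1) (fL_wd C i).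
    have [_ ->] := qpadjD (os_adj_wd hP (hf i)) wN.
    by rewrite eN fL_self f_self rmorphN1.
  rewrite -[LHS](subrK (fL g C)) fK; congr (_ + _).
  apply/matrixP => i j; rewrite [j]ord1 hamZ hamD hamK scalerDr -scalerDl.
  by rewrite -div1r -splitr scale1r.
split; split.
- by move=> /real_all[cc fs]; split=> //; exists 0.
- by move=> [[C [cg cf]] fs]; exact: (some_real C).
- exact: real_all.
- by move=> [cc fs]; have [cg cf] := cc 0; exact: (some_real 0).
Qed.
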